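(* Assume that the tensor $C$ satisfies the stated assumptions (symmetric, isotropic, homogeneous and positive), that $f\in C([0,T];L^2(\Omega;\mathbb{R}^d))$, $g\in C([0,T];H^1(\Omega;\mathbb{R}^d))$, $q\in C([0,T];L^2(\Gamma_1;\mathbb{R}^d))$, $\phi^0\in L^2(\Omega;\mathbb{R}^{d\times d}_{\rm sym})$, and that $f,g,q$ are independent of time, i.e. $\partial f/\partial t=0$, $\partial g/\partial t=0$, $\partial q/\partial t=0$. Let $\{(u_\tau^k,\phi_\tau^k)\in V(g)\times\Psi;\ k=0,\dots,N_T\}$ be the solution of the time-discrete problem: $\phi_\tau^0=\phi^0$, $$(\sigma[u_\tau^k,\phi_\tau^k],e[v])_\Psi=\ell(v)\quad\forall v\in V,\quad k=0,\dots,N_T,$$ $$\eta\overline{D}_\tau\phi_\tau^k+\alpha\phi_\tau^k-\sigma[u_\tau^k,\phi_\tau^k]=0\ \text{ in }\Psi,\quad k=1,\dots,N_T.$$ Set $E_\tau^k=E(u_\tau^k,\phi_\tau^k)$. Then for any $k=1,\dots,N_T$: (i) (Gradient flow structure) $$(\eta\overline{D}_\tau\phi_\tau^k,\psi)_\Psi=-(\partial E_\ast)(\phi_\tau^k)[\psi]\quad\forall\psi\in\Psi.$$ (ii) (Energy decay estimate) $$\overline{D}_\tau E_\tau^k+\frac{\alpha\tau}{2}\bigl\|\overline{D}_\tau\phi_\tau^k\bigr\|_\Psi^2+\frac{\tau}{2}\bigl\|\overline{D}_\tau(e[u_\tau^k]-\phi_\tau^k)\bigr\|_C^2=-\eta\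bigl\|\overline{D}_\tau\phi_\tau^k\bigr\|_\Psi^2\le0.$$
   Context: Let $d\in\{2,3\}$, $T>0$, and let $\Omega\subset\mathbb{R}^d$ be a bounded Lipschitz domain with boundary $\Gamma=\partial\Omega$. $\Gamma_0$ is an open subset of $\Gamma$ whose $(d-1)$-dimensional measure is positive and equal to that of $\overline{\Gamma}_0$, and $\Gamma_1=\Gamma\setminus\overline{\Gamma}_0$ (the case $\Gamma_0=\Gamma$, $\Gamma_1=\emptyset$ is allowed). $\eta>0$ and $\alpha\ge0$ are constants. $\mathbb{R}^{d\times d}_{\rm sym}$ is the space of real symmetric $d\times d$ matrices; $A:B=\sum_{i,j}A_{ij}B_{ij}$. Tensor $C=(c_{ijkl})$: $c_{ijkl}=\lambda\delta_{ij}\delta_{kl}+\mu(\delta_{ik}\delta_{jl}+\delta_{il}\delta_{jk})$ with constants $\lambda,\mu\in\mathbb{R}$, and there is $c_\ast>0$ with $\sum_{i,j,k,l}c_{ijkl}\xi_{ij}\xi_{kl}\ge c_\ast|\xi|^2$ for all $\xi\in\mathbb{R}^{d\times d}_{\rm sym}$, where $|\xi|^2=\sum_{i,j}\xi_{ij}^2$. It acts by $(C\xi)_{ij}=\sum_{k,l}c_{ijkl}\xi_{kl}$. Notation: $e[u]=\frac12[\nabla u+(\nabla u)^T]$, $\sigma[u,\phi]=C(e[u]-\phi)$. $X=H^1(\Omega;\mathbb{R}^d)$; $V(g)=\{v\in X: v|_{\Gamma_0}=g|_{\Gamma_0}\}$ (traces); $V=V(0)$; $\Psi=L^2(\Omega;\mathbb{R}^{d\times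 d}_{\rm sym})$. $(\phi,\psi)_\Psi=\int_\Omega\phi:\psi\,dx$, $(\phi,\psi)_C=(C\phi,\psi)_\Psi$, with norms $\|\cdot\|_\Psi$, $\|\cdot\|_C$. $(\cdot,\cdot)$ is the inner product of $L^2(\Omega;\mathbb{R}^d)$. $\ell(v)=(f,v)+\int_{\Gamma_1}q\cdot v\,ds$ (independent of time since $f,q$ are). Time discretization: $\tau>0$ is a time increment, $N_T=\lfloor T/\tau\rfloor$, $t^k=k\tau$, and $\overline{D}_\tau\rho^k=(\rho^k-\rho^{k-1})/\tau$ for any sequence $\rho^k$. Energy: $E(u,\phi)=\frac12\|e[u]-\phi\|_C^2+\frac{\alpha}{2}\|\phi\|_\Psi^2-\ell(u)$ for $(u,\phi)\in V(g)\times\Psi$. Reduced energy: $E_\ast(\psi)=\min_{v\in V(g)}E(v,\psi)$ for $\psi\in\Psi$, with Gâteaux derivative $(\partial E_\ast)(\phi)[\psi]=\frac{d}{d\varepsilon}E_\ast(\phi+\varepsilon\psi)|_{\varepsilon=0}$. *)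

(* Defs.v *)
From HB Require Import structures.
From mathcomp Require Import all_boot all_order all_algebra.
From mathcomp Require Import all_classical all_reals all_analysis.

Set Implicit Arguments.
Unset Strict Implicit.
Unset Printing Implicit Defensive.
Import Order.TTheory GRing.Theory Num.Theory.
Import numFieldNormedType.Exports.
Local Open Scope classical_set_scope.
Local Open Scope ring_scope.

(** The contraction [A : B]; for [m = 1] this is the Euclidean dot product. *)
Definition mdot (R : realType) m n (A B : 'M[R]_(m, n)) : R :=
  \sum_i \sum_j A i j * B i j.

(** The norm that MathComp-Analysis puts on matrices is the sup norm. *)
Definition enorm (R : realType) m n (A : 'M[R]_(m, n)) : R :=
  Num.sqrt (mdot A A).

(** A copy of [T] in which every set is declared measurable, so that the
    library's [mu_ext w A] is the infimum of [\sum_k w (F k)] over all countable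
    covers [F] of [A]. *)
Definition all_sets (T : Type) : Type := T.
HB.instance Definition _ (T : pointedType) := Pointed.on (all_sets T).
HB.instance Definition _ (T : pointedType) :=
  @isMeasurable.Build default_measure_display (all_sets T) discrete_measurable
    (@discrete_measurable0 T) (@discrete_measurableC T)
    (@discrete_measurableU T).

Definition cover_ext (R : realType) (T : pointedType) (w : set T -> \bar R) :
  set T -> \bar R := @mu_ext _ (all_sets T) R w.

Definition caratheodory_measure (R : realType) (T : pointedType)
    (mu : {outer_measure set T -> \bar R}) :
  {measure set (caratheodory_type mu) -> \bar R} := mu.

Section lebesgue.
Context (R : realType) (d : nat).

Definition box (a b : 'rV[R]_d) : set 'rV[R]_d :=
  [set x | forall i, a 0 i <= x 0 i < b 0 i].

(** The volume of a half-open box, and [+oo] (the infimum of the empty set) on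
    nonempty sets that are not boxes: only covers by boxes matter. *)
Definition box_volume (A : set 'rV[R]_d) : \bar R :=
  if A == set0 then 0%E
  else ereal_inf [set (\prod_i (p.2 0 i - p.1 0 i))%:E | p in
         [set p : 'rV[R]_d * 'rV[R]_d |
            (forall i, p.1 0 i <= p.2 0 i) /\ A = box p.1 p.2]].

Lemma box_volume0 : box_volume set0 = 0%E.
Proof. by rewrite /box_volume eqxx. Qed.

Lemma box_volume_ge0 A : (0 <= box_volume A)%E.
Proof.
rewrite /box_volume; case: ifPn => // _.
apply: le_ereal_inf_tmp => _ [p [pab _] <-].
by rewrite lee_fin; apply: prodr_ge0 => i _; rewrite subr_ge0.
Qed.

Definition lebesgue_outer : set 'rV[R]_d -> \bar R := cover_ext box_volume.

HB.instance Definition _ := isOuterMeasure.Build R 'rV[R]_d lebesgue_outer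
  (mu_ext0 (T := all_sets 'rV[R]_d) box_volume0 box_volume_ge0)
  (mu_ext_ge0 (T := all_sets 'rV[R]_d) box_volume_ge0)
  (@le_mu_ext _ (all_sets 'rV[R]_d) R box_volume)
  (mu_ext_sigma_subadditive (T := all_sets 'rV[R]_d) box_volume_ge0).

Definition lebesgue :
    {measure set (caratheodory_type lebesgue_outer) -> \bar R} :=
  caratheodory_measure lebesgue_outer.

End lebesgue.

Section hausdorff.
Context (R : realType) (d s : nat).

Definition ediam (A : set 'rV[R]_d) : \bar R :=
  ereal_sup [set (enorm (x.1 - x.2))%:E | x in A `*` A].

(** The volume of the unit ball of [R^n], by the recursion in steps of two. *)
Fixpoint unit_ball_volume (n : nat) : R :=
  match n with
  | 0 => 1
  | 1 => 2
  | m.+2 => 2 * pi / n%:R * unit_ball_volume m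
  end.

Definition hausdorff_weight (delta : R) (A : set 'rV[R]_d) : \bar R :=
  if A == set0 then 0%E
  else if (ediam A <= delta%:E)%E
       then ((unit_ball_volume s / 2 ^+ s)%:E * ediam A ^+ s)%E
       else +oo%E.

Lemma hausdorff_weight0 delta : hausdorff_weight delta set0 = 0%E.
Proof. by rewrite /hausdorff_weight eqxx. Qed.

Lemma unit_ball_volume_ge0 n : 0 <= unit_ball_volume n.
Proof.
suff : 0 <= unit_ball_volume n /\ 0 <= unit_ball_volume n.+1 by case.
elim: n => [|n [h0 h1]]; first by split.
by split => //=; rewrite mulr_ge0// divr_ge0// mulr_ge0// pi_ge0.
Qed.

Lemma hausdorff_weight_ge0 delta A : (0 <= hausdorff_weight delta A)%E.
Proof.
rewrite /hausdorff_weight; case: ifPn => // A0; case: ifPn => // _.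
rewrite mule_ge0//.
  by rewrite lee_fin divr_ge0// ?unit_ball_volume_ge0// exprn_ge0.
rewrite expe_ge0//.
have [x Ax] : A !=set0 by apply/set0P.
apply: ereal_sup_ubound; exists (x, x) => //=.
rewrite subrr /enorm /mdot big1 ?sqrtr0// => i _.
by rewrite big1// => j _; rewrite mxE mul0r.
Qed.

Definition hausdorff_outer (A : set 'rV[R]_d) : \bar R :=
  ereal_sup [set cover_ext (hausdorff_weight delta) A | delta in [set e | 0 < e]].

Let he (delta : R) := cover_ext (hausdorff_weight delta).

Let he_ge0 delta A : (0 <= he delta A)%E.
Proof. exact: (mu_ext_ge0 (T := all_sets 'rV[R]_d) (hausdorff_weight_ge0 delta)). Qed.

Lemma hausdorff_outer_ge0 A : (0 <= hausdorff_outer A)%E.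
Proof.
apply: le_trans (he_ge0 1 A) _; apply: ereal_sup_ubound.
by exists 1 => //=.
Qed.

Lemma hausdorff_outer0 : hausdorff_outer set0 = 0%E.
Proof.
apply/eqP; rewrite eq_le hausdorff_outer_ge0 andbT.
apply: ge_ereal_sup => _ [delta _ <-].
by have <- := mu_ext0 (T := all_sets 'rV[R]_d) (hausdorff_weight0 delta)
  (hausdorff_weight_ge0 delta).
Qed.

Lemma le_hausdorff_outer :
  {homo hausdorff_outer : A B / A `<=` B >-> (A <= B)%E}.
Proof.
move=> A B AB; apply: ge_ereal_sup => _ [delta d0 <-].
apply: le_trans (_ : (he delta B <= _)%E).
  exact: (@le_mu_ext _ (all_sets 'rV[R]_d) R).
by apply: ereal_sup_ubound; exists delta.
Qed.

Lemma hausdorff_outer_sigma_subadditive : sigma_subadditive hausdorff_outer.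
Proof.
move=> F; apply: ge_ereal_sup => _ [delta d0 <-].
apply: le_trans (mu_ext_sigma_subadditive (T := all_sets 'rV[R]_d)
  (hausdorff_weight_ge0 delta) F) _.
apply: lee_nneseries => [k _ _|k _]; first exact: he_ge0.
by apply: ereal_sup_ubound; exists delta.
Qed.

HB.instance Definition _ := isOuterMeasure.Build R 'rV[R]_d hausdorff_outer
  hausdorff_outer0 hausdorff_outer_ge0 le_hausdorff_outer
  hausdorff_outer_sigma_subadditive.

Definition hausdorff :
    {measure set (caratheodory_type hausdorff_outer) -> \bar R} :=
  caratheodory_measure hausdorff_outer.

End hausdorff.

Notation surface R d := (hausdorff R d d.-1).

Section L2.
Context (disp : measure_display) (T : measurableType disp) (R : realType).
Context (mu : {measure set T -> \bar R}) (D : set T) (m n : nat).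
Implicit Types F G : T -> 'M[R]_(m, n).

(** Functions are representatives; equality in [L^2] is equality a.e. *)
Definition L2 F : Prop :=
  forall i j, (fun x => F x i j) \_ D \in Lfun mu 2%:E.

Definition L2dot F G : R := \int[mu]_(x in D) mdot (F x) (G x).

Definition L2norm F : R := Num.sqrt (L2dot F F).

End L2.
Arguments L2 {disp T R} mu D {m n} F.
Arguments L2dot {disp T R} mu D {m n} F G.
Arguments L2norm {disp T R} mu D {m n} F.

Section time.
Context (R : realType) (X : lmodType R) (N : X -> R) (T : R).

Definition time_continuous (F : R -> X) : Prop :=
  forall t, 0 <= t <= T ->
    N (F s - F t) @[s --> within `[0, T] (nbhs t)] --> (0 : R).

(** The time derivative exists and vanishes. *)
Definition time_derivative0 (F : R -> X) : Prop :=
  forall t, 0 < t < T ->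
    N ((s - t)^-1 *: (F s - F t)) @[s --> t^'] --> (0 : R).

End time.

Definition boundary (X : topologicalType) (A : set X) : set X :=
  closure A `\` A°.

Section domain.
Context (R : realType) (d : nat).

(** Near each boundary point, the domain is the strict epigraph of a Lipschitz
    function over the hyperplane orthogonal to some unit vector [nu]; [h] is only
    evaluated on that hyperplane. *)
Definition lipschitz_boundary (Om : set 'rV[R]_d) : Prop :=
  forall x, boundary Om x ->
    exists (r L : R) (nu : 'rV[R]_d) (h : 'rV[R]_d -> R),
      [/\ 0 < r, mdot nu nu = 1,
          (forall y z, `|h y - h z| <= L * enorm (y - z)) &
          (forall y, enorm (y - x) < r ->
             (Om y <-> h (y - mdot y nu *: nu) < mdot y nu))].

Definition bounded_lipschitz_domain (Om : set 'rV[R]_d) : Prop :=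
  [/\ open Om, connected Om, Om !=set0,
      (exists M : R, forall x, Om x -> enorm x <= M) & lipschitz_boundary Om].

(** [Gam0] is relatively open in the boundary, and has positive measure equal to
    that of its closure. *)
Definition dirichlet_part (Om Gam0 : set 'rV[R]_d) : Prop :=
  [/\ exists2 U : set 'rV[R]_d, open U & Gam0 = boundary Om `&` U,
      (0 < surface R d Gam0)%E &
      surface R d Gam0 = surface R d (closure Gam0)].

Definition neumann_part (Om Gam0 : set 'rV[R]_d) : set 'rV[R]_d :=
  boundary Om `\` closure Gam0.

End domain.

Notation vfield R d := ('rV[R]_d -> 'rV[R]_d).
Notation tfield R d := ('rV[R]_d -> 'M[R]_d).

Section sobolev.
Context (R : realType) (d : nat).
Implicit Types Om : set 'rV[R]_d.

Definition partial (i : 'I_d) (f : 'rV[R]_d -> R) : 'rV[R]_d -> R :=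
  fun x => 'D_(delta_mx 0 i) f x.

(** [C^oo]: all iterated partial derivatives exist and are continuous. *)
Definition smooth (f : 'rV[R]_d -> R) : Prop :=
  forall s : seq 'I_d,
    continuous (foldr partial f s) /\
    forall i x, derivable (foldr partial f s) x (delta_mx 0 i).

Definition test_function Om (f : 'rV[R]_d -> R) : Prop :=
  [/\ smooth f, compact (closure [set x | f x != 0]) &
      closure [set x | f x != 0] `<=` Om].

(** [G i j] is the weak derivative of [v i] in direction [j]. *)
Definition weak_gradient Om (v : vfield R d) (G : tfield R d) : Prop :=
  forall f, test_function Om f -> forall i j,
    \int[lebesgue R d]_(x in Om) (v x 0 i * partial j f x) =
    - \int[lebesgue R d]_(x in Om) (G x i j * f x).

(** An element of [H^1(Om; R^d)] is given by a function together with its weak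
    gradient, which the function determines almost everywhere in [Om]. *)
Definition H1 Om : set (vfield R d * tfield R d) :=
  [set u | [/\ L2 (lebesgue R d) Om u.1, L2 (lebesgue R d) Om u.2 &
               weak_gradient Om u.1 u.2]].

Definition H1norm Om (u : vfield R d * tfield R d) : R :=
  Num.sqrt (L2norm (lebesgue R d) Om u.1 ^+ 2 +
            L2norm (lebesgue R d) Om u.2 ^+ 2).

(** The trace operator [H^1(Om) -> L^2(boundary Om)]: the bounded linear operator
    that extends the restriction to the boundary of functions smooth up to the
    boundary. On a bounded Lipschitz domain it exists and is unique (up to
    equality a.e. on the boundary). *)
Record trace_operator Om (gam : vfield R d * tfield R d -> vfield R d) : Prop := {
  trace_L2 : forall u, H1 Om u -> L2 (surface R d) (boundary Om) (gam u);
  trace_linear : forall (a : R) u v, H1 Om u -> H1 Om v ->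
    {ae surface R d, forall x, boundary Om x ->
       gam (a *: u + v) x = a *: gam u x + gam v x};
  trace_bounded : exists K : R, forall u, H1 Om u ->
    L2norm (surface R d) (boundary Om) (gam u) <= K * H1norm Om u;
  trace_smooth : forall u (w : vfield R d), H1 Om u ->
    (forall i, smooth (fun x => w x 0 i)) -> (forall x, Om x -> u.1 x = w x) ->
    {ae surface R d, forall x, boundary Om x -> gam u x = w x} }.

(** The affine space [V(g)]; the linear space [V] is the case [g = 0]. *)
Definition affV Om Gam0 (gam : vfield R d * tfield R d -> vfield R d)
    (g : vfield R d * tfield R d) : set (vfield R d * tfield R d) :=
  [set v | H1 Om v /\
     {ae surface R d, forall x, Gam0 x -> gam v x = gam g x}].

Definition Psi Om : set (tfield R d) :=
  [set phi | L2 (lebesgue R d) Om phi /\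
     forall x, Om x -> (phi x)^T = phi x].

End sobolev.

Section elasticity.
Context (R : realType) (d : nat) (lambda mu : R).

Definition stiff (i j k l : 'I_d) : R :=
  lambda * (i == j)%:R * (k == l)%:R +
  mu * ((i == k)%:R * (j == l)%:R + (i == l)%:R * (j == k)%:R).

Definition stiff_positive : Prop :=
  exists2 c : R, 0 < c & forall xi : 'M[R]_d, xi^T = xi ->
    c * (\sum_i \sum_j xi i j ^+ 2) <=
    \sum_i \sum_j \sum_k \sum_l stiff i j k l * xi i j * xi k l.

Definition stiffM (xi : 'M[R]_d) : 'M[R]_d :=
  \matrix_(i, j) \sum_k \sum_l stiff i j k l * xi k l.

Definition strain (u : vfield R d * tfield R d) : tfield R d :=
  fun x => 2^-1 *: (u.2 x + (u.2 x)^T).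

Definition stress u (phi : tfield R d) : tfield R d :=
  fun x => stiffM ((strain u - phi) x).

Section energy.
Context (Om Gam0 : set 'rV[R]_d).
Context (gam : vfield R d * tfield R d -> vfield R d) (alpha : R).
Context (f q : vfield R d) (g : vfield R d * tfield R d).

Definition dotPsi (phi psi : tfield R d) : R := L2dot (lebesgue R d) Om phi psi.
Definition normPsi (phi : tfield R d) : R := Num.sqrt (dotPsi phi phi).
Definition dotC (phi psi : tfield R d) : R :=
  dotPsi (fun x => stiffM (phi x)) psi.
Definition normC (phi : tfield R d) : R := Num.sqrt (dotC phi phi).

Definition load (v : vfield R d * tfield R d) : R :=
  L2dot (lebesgue R d) Om f v.1 +
  L2dot (surface R d) (neumann_part Om Gam0) q (gam v).

Definition energy (u : vfield R d * tfield R d) (phi : tfield R d) : R :=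
  2^-1 * normC (strain u - phi) ^+ 2 + alpha / 2 * normPsi phi ^+ 2 - load u.

(** The minimum of [energy v psi] over [v] in [V(g)], as an infimum: see
    [reduced_energyE]. *)
Definition reduced_energy (psi : tfield R d) : R :=
  inf [set energy v psi | v in affV Om Gam0 gam g].

Lemma reduced_energyE psi u : affV Om Gam0 gam g u ->
  (forall v, affV Om Gam0 gam g v -> energy u psi <= energy v psi) ->
  reduced_energy psi = energy u psi.
Proof.
move=> Vu umin; apply/eqP; rewrite eq_le; apply/andP; split.
  apply: ge_inf; last by exists u.
  by exists (energy u psi) => _ [v Vv <-]; exact: umin.
apply: lb_le_inf; first by exists (energy u psi), u.
by move=> _ [v Vv <-]; exact: umin.
Qed.

End energy.
End elasticity.

Definition gateaux (R : realType) (X : lmodType R) (F : X -> R) (x v : X) : R :=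
  derive1 (fun eps : R => F (x + eps *: v)) 0.

Definition gateaux_derivable (R : realType) (X : lmodType R) (F : X -> R)
  (x v : X) : Prop := derivable (fun eps : R => F (x + eps *: v)) 0 1.

(** The backward difference quotient; only used for [k >= 1]. *)
Definition Dbar (R : realType) (X : lmodType R) (tau : R) (rho : nat -> X)
  (k : nat) : X := tau^-1 *: (rho k - rho k.-1).

(* Main.v *)
Require Import Defs.
From mathcomp Require Import all_boot all_order all_algebra.
From mathcomp Require Import all_classical all_reals all_analysis.
From mathcomp Require Import measurable_realfun.
From mathcomp Require Import ring lra.
Set Implicit Arguments.
Unset Strict Implicit.
Unset Printing Implicit Defensive.
Import Order.TTheory GRing.Theory Num.Theory.
Import numFieldNormedType.Exports.
Local Open Scope classical_set_scope.
Local Open Scope ring_scope.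

(** The energy is a quadratic functional, so it has an exact second order
    expansion. Around an equilibrium [u] for the internal variable [phi], the
    terms linear in an admissible change [w] of displacement cancel and
    [[
      E(u + w, phi + chi) = E(u, phi) + (alpha phi - sigma[u, phi], chi)
        + alpha/2 |chi|^2 + 1/2 |e[w] - chi|_C^2
    ]]
    (lemma [energy_shift]). Both claims follow from this identity.

    Gradient flow. The last square is nonnegative because [C] is positive, and it
    is [1/2 |chi|_C^2] for [w = 0]. Taking the infimum over [w] with
    [chi = eps psi] places the reduced energy between two parabolas in [eps] with
    the same value and the same slope [(alpha phi - sigma[u, phi], psi)] at
    [eps = 0] (lemmas [reduced_energy_bounds] and
    [is_derive_between_parabolas]). So the reduced energy is differentiable with
    this slope, which by the flow rule is [- (eta Dbar phi, psi)].

    Energy decay. Take [w = u^(k-1) - u^k] and [chi = phi^(k-1) - phi^k] at step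
    [k]: the left-hand side is the previous energy, the linear term is
    [eta tau |Dbar phi|^2] by the flow rule, and the two squares are the
    numerical dissipation terms. This [w] is admissible, and the previous energy
    involves the same load, because the data are constant in time: a curve with
    zero derivative for a seminorm stays at zero distance from its initial point
    (lemma [static_semi_norm]), and loads and traces do not see functions of zero
    norm ([load_static], [affV_static]).

    The analysis behind these computations is the linearity of integrals, that
    is, integrability. For products of [L^2] functions it is Hoelder's
    inequality. For the linearity of weak derivatives it requires that test
    functions be Lebesgue measurable, which is proved from the definition of the
    outer measure by covers with boxes: half-spaces satisfy the Caratheodory
    condition, so boxes and open sets are measurable. *)

(** * Semi-inner products *)

Section semi_inner_product.
Context (R : realType) (X : lmodType R).
Implicit Types (P : set X) (B : X -> X -> R).

(** Spaces of representatives are handled without passing to quotients: all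
    that is known of the forms below is that they are bilinear and nonnegative
    on a subspace [P] of a function space, and a null vector need not vanish. *)
Record semi_inner P B : Prop := {
  semi_inner_dom0 : P 0;
  semi_inner_dom : forall a x y, P x -> P y -> P (a *: x + y);
  semi_inner_lin : forall a x y z, P x -> P y -> P z ->
    B (a *: x + y) z = a * B x z + B y z;
  semi_innerC : forall x y, B x y = B y x;
  semi_inner_ge0 : forall x, P x -> 0 <= B x x }.

Context (P : set X) (B : X -> X -> R) (hB : semi_inner P B).

Lemma semi_inner_domZ a x : P x -> P (a *: x).
Proof.
by move=> Px; rewrite -[_ *: _]addr0; exact: (semi_inner_dom hB _ Px (semi_inner_dom0 hB)).
Qed.

Lemma semi_inner_domD x y : P x -> P y -> P (x + y).
Proof. by move=> Px Py; rewrite -[x]scale1r; exact: (semi_inner_dom hB). Qed.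

Lemma semi_inner_domB x y : P x -> P y -> P (x - y).
Proof. by move=> Px Py; rewrite addrC -scaleN1r; exact: (semi_inner_dom hB). Qed.

Lemma semi_innerDl x y z : P x -> P y -> P z -> B (x + y) z = B x z + B y z.
Proof.
by move=> Px Py Pz; have := semi_inner_lin hB 1 Px Py Pz; rewrite scale1r mul1r.
Qed.

Lemma semi_inner0l z : P z -> B 0 z = 0.
Proof.
move=> Pz; have P0 := semi_inner_dom0 hB.
have := semi_innerDl P0 P0 Pz; rewrite addr0 => /eqP.
by rewrite -subr_eq0 opprD addNKr oppr_eq0 => /eqP.
Qed.

Lemma semi_innerZl a x z : P x -> P z -> B (a *: x) z = a * B x z.
Proof.
move=> Px Pz; have P0 := semi_inner_dom0 hB.
by have := semi_inner_lin hB a Px P0 Pz; rewrite addr0 semi_inner0l// addr0.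
Qed.

Lemma semi_innerBl x y z : P x -> P y -> P z -> B (x - y) z = B x z - B y z.
Proof.
by move=> Px Py Pz; rewrite addrC -scaleN1r (semi_inner_lin hB)// mulN1r addrC.
Qed.

Lemma semi_innerDr x y z : P x -> P y -> P z -> B z (x + y) = B z x + B z y.
Proof.
by move=> Px Py Pz; rewrite (semi_innerC hB) semi_innerDl// !(semi_innerC hB z).
Qed.

Lemma semi_innerZr a x z : P x -> P z -> B z (a *: x) = a * B z x.
Proof. by move=> Px Pz; rewrite (semi_innerC hB) semi_innerZl// (semi_innerC hB x). Qed.

Lemma semi_innerBr x y z : P x -> P y -> P z -> B z (x - y) = B z x - B z y.
Proof.
by move=> Px Py Pz; rewrite (semi_innerC hB) semi_innerBl// !(semi_innerC hB z).
Qed.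

Definition semi_norm x := Num.sqrt (B x x).

Lemma sqr_semi_norm x : P x -> semi_norm x ^+ 2 = B x x.
Proof. by move=> Px; rewrite sqr_sqrtr// (semi_inner_ge0 hB). Qed.

(** Nonnegativity of [t |-> B (x + t y) (x + t y)]. If [B y y = 0], this
    function is affine, so its slope [2 B x y] vanishes. *)
Lemma cauchy_schwarz x y : P x -> P y -> `|B x y| <= semi_norm x * semi_norm y.
Proof.
move=> Px Py; rewrite -sqrtrM ?(semi_inner_ge0 hB)// -sqrtr_sqr ler_sqrt; last first.
  by rewrite mulr_ge0// (semi_inner_ge0 hB).
have Q t : 0 <= B x x + 2 * t * B x y + t ^+ 2 * B y y.
  have Pty : P (t *: y) by exact: semi_inner_domZ.
  have := semi_inner_ge0 hB (semi_inner_domD Px Pty).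
  rewrite semi_innerDl ?semi_innerDr//; last exact: semi_inner_domD.
  rewrite !semi_innerZl ?semi_innerZr// (semi_innerC hB y x).
  by move=> /le_trans; apply; rewrite le_eqVlt; apply/orP; left; apply/eqP; ring.
have [y0|y0] := eqVneq (B y y) 0.
  suff -> : B x y = 0 by rewrite y0 mulr0 expr0n.
  apply/eqP; apply/negPn/negP => xy0.
  (* the zero of [B x x + 1 + 2 t B x y] *)
  have := Q (- (B x x + 1) / (2 * B x y)); rewrite y0 mulr0 addr0.
  have -> : B x x + 2 * (- (B x x + 1) / (2 * B x y)) * B x y = -1 by field.
  lra.
have yy : 0 < B y y by rewrite lt_def y0 (semi_inner_ge0 hB).
(* the minimum point of the quadratic [Q] *)
have := Q (- B x y / B y y).
have -> : B x x + 2 * (- B x y / B y y) * B x y + (- B x y / B y y) ^+ 2 * B y y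
    = B x x - B x y ^+ 2 / B y y by field.
by rewrite subr_ge0 ler_pdivrMr.
Qed.

Lemma semi_normD x y : P x -> P y -> semi_norm (x + y) <= semi_norm x + semi_norm y.
Proof.
move=> Px Py; rewrite -(@ler_pXn2r _ 2) ?nnegrE ?addr_ge0 ?sqrtr_ge0//.
have Pxy := semi_inner_domD Px Py.
rewrite sqrrD !sqr_semi_norm// semi_innerDl ?semi_innerDr// (semi_innerC hB y x).
by have := ler_norml (B x y); have := cauchy_schwarz Px Py; have := ler_norm (B x y); lra.
Qed.

Lemma semi_normZ a x : P x -> semi_norm (a *: x) = `|a| * semi_norm x.
Proof.
move=> Px; have Pax := semi_inner_domZ a Px.
rewrite /semi_norm semi_innerZl ?semi_innerZr// mulrA -expr2 sqrtrM ?sqr_ge0//.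
by rewrite sqrtr_sqr.
Qed.

Lemma semi_inner_null x y : P x -> P y -> semi_norm x = 0 -> B x y = 0.
Proof.
move=> Px Py x0; apply/eqP; rewrite -normr_eq0 eq_le normr_ge0 andbT.
by have := cauchy_schwarz Px Py; rewrite x0 mul0r.
Qed.

End semi_inner_product.

(** * The space of square integrable functions *)

Section L2_theory.
Context (disp : measure_display) (T : measurableType disp) (R : realType).
Context (mu : {measure set T -> \bar R}).

Lemma restrict_lin (D : set T) (a : R) (f g : T -> R) :
  (fun x => a * f x + g x) \_ D = a *: (f \_ D) + (g \_ D).
Proof.
apply/funext => x; rewrite -[RHS]/(a * (f \_ D) x + (g \_ D) x) /patch.
by case: ifP => // _; rewrite mulr0 addr0.
Qed.

Lemma Lfun2_lin (a : R) (f g : T -> R) :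
  f \in Lfun mu 2%:E -> g \in Lfun mu 2%:E -> a *: f + g \in Lfun mu 2%:E.
Proof.
move=> hf hg; have p1 : (1 <= 2%:E :> \bar R)%E by rewrite lee_fin ler1n.
exact: (Lfun_submod_closed mu p1).2.
Qed.

Context (D : set T).

Section fixed_size.
Context (m n : nat).
Implicit Types F G H : T -> 'M[R]_(m, n).

Lemma L2_0 : L2 mu D (0 : T -> 'M[R]_(m, n)).
Proof.
move=> i j; have p1 : (1 <= 2%:E :> \bar R)%E by rewrite lee_fin ler1n.
rewrite (_ : _ \_ _ = 0); first exact: (Lfun_submod_closed mu p1).1.
by apply/funext => x; rewrite /patch; case: ifP => // _; exact: mxE.
Qed.

Lemma L2_lin a F G : L2 mu D F -> L2 mu D G -> L2 mu D (a *: F + G).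
Proof.
move=> hF hG i j.
have -> : (fun x => (a *: F + G) x i j) = (fun x => a * F x i j + G x i j).
  by apply/funext => x; rewrite -[LHS]/((a *: F x + G x) i j) !mxE.
by rewrite restrict_lin; apply: Lfun2_lin; [exact: hF|exact: hG].
Qed.

(** Every integral over [D] is computed on the whole space for the integrand cut
    off outside [D]. Square integrability is a statement on cut-off functions
    too, so [D] itself enters only through cut-offs. *)
Lemma restrict_mdot F G : (fun x => mdot (F x) (G x)) \_ D =
  \sum_i \sum_j ((fun x => F x i j) \_ D \* (fun x => G x i j) \_ D).
Proof.
apply/funext => x; rewrite fct_sumE /patch; under eq_bigr do rewrite fct_sumE/=.
case: ifP => //= _; rewrite big1// => i _; rewrite big1// => j _.
by rewrite mulr0.
Qed.

Lemma integrable_mdot F G : L2 mu D F -> L2 mu D G ->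
  mu.-integrable setT (EFin \o ((fun x => mdot (F x) (G x)) \_ D)).
Proof.
move=> hF hG; apply/Lfun1_integrable; rewrite restrict_mdot.
have [L0 L1] := Lfun_addr_closed mu (lexx 1%E).
elim/big_ind : _ => // i _; elim/big_ind : _ => // j _.
by apply: Lfun2_mul_Lfun1; [exact: hF|exact: hG].
Qed.

Lemma L2dotE F G :
  L2dot mu D F G = \int[mu]_x ((fun x => mdot (F x) (G x)) \_ D) x.
Proof. by rewrite /L2dot Rintegral_mkcond. Qed.

Lemma mdotC (A B : 'M[R]_(m, n)) : mdot A B = mdot B A.
Proof. by apply: eq_bigr => i _; apply: eq_bigr => j _; rewrite mulrC. Qed.

Lemma mdot_ge0 (A : 'M[R]_(m, n)) : 0 <= mdot A A.
Proof. by apply: sumr_ge0 => i _; apply: sumr_ge0 => j _; rewrite -expr2 sqr_ge0. Qed.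

Lemma L2dot_ge0 F : 0 <= L2dot mu D F F.
Proof. by apply: Rintegral_ge0 => x _; exact: mdot_ge0. Qed.

Lemma mdot_lin a (A B C : 'M[R]_(m, n)) :
  mdot (a *: A + B) C = a * mdot A C + mdot B C.
Proof.
rewrite /mdot mulr_sumr -big_split; apply: eq_bigr => i _.
rewrite mulr_sumr -big_split; apply: eq_bigr => j _ /=.
by rewrite !mxE mulrDl mulrA.
Qed.

Lemma mdot_eq0 (A : 'M[R]_(m, n)) : mdot A A = 0 -> A = 0.
Proof.
move=> /eqP; rewrite psumr_eq0 => [/allP A0|i _]; last first.
  by apply: sumr_ge0 => j _; rewrite -expr2 sqr_ge0.
apply/matrixP => i j; rewrite mxE.
have := A0 i (mem_index_enum _); rewrite psumr_eq0 => [/allP Ai0|k _]; last first.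
  by rewrite -expr2 sqr_ge0.
by have := Ai0 j (mem_index_enum _); rewrite /= -expr2 sqrf_eq0 => /eqP.
Qed.

Lemma L2_semi_inner : semi_inner (L2 mu D) (@L2dot _ _ _ mu D m n).
Proof.
split.
- exact: L2_0.
- exact: L2_lin.
- move=> a F G H hF hG hH; rewrite !L2dotE.
  have iFH := integrable_mdot hF hH; have iGH := integrable_mdot hG hH.
  rewrite -RintegralZl// -RintegralD//=; last exact: (integrableZl measurableT a iFH).
  apply: eq_Rintegral => x _; rewrite /patch; case: ifP => _ /=.
    exact: mdot_lin.
  by rewrite mulr0 addr0.
- by move=> F G; apply: eq_Rintegral => x _; rewrite mdotC.
- by move=> F _; exact: L2dot_ge0.
Qed.

Lemma L2dot_ae F G H : L2 mu D F -> L2 mu D G -> L2 mu D H ->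
  {ae mu, forall x, D x -> F x = G x} -> L2dot mu D F H = L2dot mu D G H.
Proof.
move=> hF hG hH FG; rewrite !L2dotE /Rintegral; congr fine.
apply: ae_eq_integral => //.
- by have /integrableP[] := integrable_mdot hF hH.
- by have /integrableP[] := integrable_mdot hG hH.
apply: filterS FG => x FG _; rewrite /patch; case: ifPn => // /set_mem Dx.
by rewrite FG.
Qed.

Lemma L2norm0_ae F : L2 mu D F -> L2norm mu D F = 0 ->
  {ae mu, forall x, D x -> F x = 0}.
Proof.
move=> hF F0.
have {}F0 : L2dot mu D F F = 0.
  by rewrite -(sqr_semi_norm L2_semi_inner hF) [semi_norm _ _]F0 expr0n.
have iF := integrable_mdot hF hF; have /integrableP[mF _] := iF.
have : ae_eq mu setT (EFin \o ((fun x => mdot (F x) (F x)) \_ D)) (cst 0%E).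
  apply/(ae_eq_integral_abs mu measurableT mF).
  rewrite (eq_integral (EFin \o ((fun x => mdot (F x) (F x)) \_ D))); last first.
    move=> x _; rewrite gee0_abs// lee_fin /patch; case: ifP => // _.
    exact: mdot_ge0.
  rewrite -[LHS]fineK; last exact: integrable_fin_num.
  by rewrite -[fine _]/(\int[mu]_x _) -L2dotE F0.
apply: filterS => x /(_ Logic.I) + Dx; rewrite /= /patch mem_set//.
by move=> [/mdot_eq0].
Qed.

End fixed_size.
End L2_theory.

(** * Lebesgue measurability of continuous functions *)

(** If cutting by [H] does not increase the weight of any covering set, then it
    does not increase the outer measure: cut each set of a cover in two. *)
Lemma cover_ext_split (R : realType) (T : pointedType) (w : set T -> \bar R)
    (H : set T) :
  (forall A, 0 <= w A)%E ->
  (forall A, w (A `&` H) + w (A `&` ~` H) <= w A)%E ->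
  forall X, (cover_ext w (X `&` H) + cover_ext w (X `&` ~` H)
             <= cover_ext w X)%E.
Proof.
move=> w0 wH X; apply: le_ereal_inf_tmp => _ [F [mF XF] <-].
have cov K : (cover_ext w (X `&` K) <= \sum_(k <oo) w (F k `&` K))%E.
  apply: ereal_inf_lbound; exists (fun k => F k `&` K) => //; split=> //.
  by rewrite -setI_bigcupl; apply: setSI.
apply: le_trans (leeD (cov H) (cov (~` H))) _.
rewrite -nneseriesD//; apply: lee_nneseries => // k _ .
  by rewrite adde_ge0.
Qed.

Section lebesgue_boxes.
Context (R : realType) (d : nat).
Implicit Types a b : 'rV[R]_d.

Lemma box_volume_le a b : (forall i, a 0 i <= b 0 i) ->
  (box_volume (box a b) <= (\prod_i (b 0 i - a 0 i))%:E)%E.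
Proof.
move=> ab; rewrite /box_volume; case: ifPn => _.
  by rewrite lee_fin prodr_ge0// => i _; rewrite subr_ge0.
by apply: ereal_inf_lbound; exists (a, b).
Qed.

Definition set_coord a (i : 'I_d) (m : R) : 'rV[R]_d :=
  \row_j (if j == i then m else a 0 j).

Definition halfspace (i : 'I_d) (c : R) : set 'rV[R]_d :=
  [set x | x 0 i < c].

(** A hyperplane orthogonal to a coordinate axis cuts a box into two boxes whose
    volumes add up. *)
Lemma box_volume_split (i : 'I_d) (c : R) (A : set 'rV[R]_d) :
  (box_volume (A `&` halfspace i c) + box_volume (A `&` ~` halfspace i c)
   <= box_volume A)%E.
Proof.
set H := halfspace i c.
have [->|A0] := eqVneq A set0.
  by rewrite !set0I box_volume0 adde0.
rewrite [in leRHS]/box_volume (negbTE A0).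
apply: le_ereal_inf_tmp => _ [[a b] [/= ab ->] <-].
(* the abscissa of the cut, moved into [a_i, b_i] if it misses the box *)
pose m := Num.min (b 0 i) (Num.max (a 0 i) c).
have am : a 0 i <= m by rewrite le_min ab le_max lexx.
have mb : m <= b 0 i by rewrite ge_min lexx.
have cm x : a 0 i <= x -> x < b 0 i -> (x < c) = (x < m).
  by move=> ax xb; rewrite lt_min xb lt_max ltNge ax.
have -> : box a b `&` H = box a (set_coord b i m).
  apply/seteqP; split=> x /=.
    move=> [xab xc] j; rewrite mxE; case: eqP => [->|_]; last exact: xab.
    by have /andP[ax xb] := xab i; rewrite ax/= -(cm _ ax xb).
  move=> xab; have /andP[ax] := xab i; rewrite mxE eqxx => xm.
  have xb := lt_le_trans xm mb.
  split; last by rewrite /H/halfspace/= (cm _ ax xb).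
  by move=> j; have := xab j; rewrite mxE; case: eqP => [->|//]; rewrite ax xb.
have -> : box a b `&` ~` H = box (set_coord a i m) b.
  apply/seteqP; split=> x /=.
    move=> [xab /negP xc] j; rewrite mxE; case: eqP => [->|_]; last exact: xab.
    by have /andP[ax xb] := xab i; rewrite xb andbT leNgt -(cm _ ax xb).
  move=> xab; have /andP[] := xab i; rewrite mxE eqxx => mx xb.
  have ax := le_trans am mx.
  split; last by rewrite /H/halfspace/= (cm _ ax xb); apply/negP; rewrite -leNgt.
  by move=> j; have := xab j; rewrite mxE; case: eqP => [->|//]; rewrite ax xb.
apply: le_trans (leeD (box_volume_le _) (box_volume_le _)) _.
- by move=> j; rewrite mxE; case: eqP => [->|].
- by move=> j; rewrite mxE; case: eqP => [->|].
rewrite -EFinD lee_fin (bigD1 i)//= [X in _ + X <= _](bigD1 i)//= [leRHS](bigD1 i)//=.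
rewrite !mxE eqxx.
under eq_bigr => j /negbTE ji do rewrite mxE ji.
under [X in _ + _ * X]eq_bigr => j /negbTE ji do rewrite mxE ji.
by rewrite -mulrDl addrC subrKA.
Qed.

Lemma measurable_halfspace (i : 'I_d) (c : R) :
  measurable (halfspace i c : set (caratheodory_type (@lebesgue_outer R d))).
Proof.
apply: le_caratheodory_measurable => X.
apply: cover_ext_split; first exact: box_volume_ge0.
exact: box_volume_split.
Qed.


Lemma measurable_box a b :
  measurable (box a b : set (caratheodory_type (@lebesgue_outer R d))).
Proof.
have -> : box a b = \bigcap_(i in [set: 'I_d])
    (~` halfspace i (a 0 i) `&` halfspace i (b 0 i)).
  apply/seteqP; split=> x /= xab i.
    move=> _; have /andP[ax xb] := xab i; split=> //=.
    by apply/negP; rewrite -leNgt.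
  by have [/= /negP] := xab i Logic.I; rewrite -leNgt => -> ->.
apply: (@fin_bigcap_measurable _ (caratheodory_type (@lebesgue_outer R d))) => //.
move=> i _; apply: measurableI; last exact: measurable_halfspace.
by apply: measurableC; exact: measurable_halfspace.
Qed.

Lemma lebesgue_box_lty a b : (lebesgue R d (box a b) < +oo)%E.
Proof.
have [ab|] := pselect (forall i, a 0 i <= b 0 i); last first.
  move=> /existsNP[i /negP]; rewrite -ltNge => ba.
  rewrite (_ : box a b = set0) ?measure0// -subset0 => x /(_ i)/andP[ax xb].
  by move: (le_lt_trans ax (lt_trans xb ba)); rewrite ltxx.
apply: (@le_lt_trans _ _ (box_volume (box a b))); last first.
  exact: le_lt_trans (box_volume_le ab) (ltry _).
pose F (k : nat) : set 'rV[R]_d := if k is 0%N then box a b else set0.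
apply: ereal_inf_lbound; exists F; first by split=> // x xab; exists 0%N.
rewrite (nneseriesD1 (n := 0%N))//=; last by move=> k _; exact: box_volume_ge0.
by rewrite eseries0 ?adde0// => -[|k]//= _ _; exact: box_volume0.
Qed.

(** An open set is the union of the boxes with rational corners it contains. *)
Lemma measurable_open (U : set 'rV[R]_d) : open U ->
  measurable (U : set (caratheodory_type (@lebesgue_outer R d))).
Proof.
move=> oU; pose B (p : 'rV[rat]_d * 'rV[rat]_d) : set 'rV[R]_d :=
  box (map_mx ratr p.1) (map_mx ratr p.2).
have -> : U = \bigcup_p (if `[< B p `<=` U >] then B p else set0).
  apply/seteqP; split=> x; last by move=> [p _]; case: asboolP => // + Bpx; apply.
  move=> Ux; have : nbhs x U by apply: open_nbhs_nbhs.
  rewrite -nbhs_ballE => -[e /= e0 xU].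
  have [a xa] : {a : 'I_d -> rat & forall i, ratr (a i) \in `]x 0 i - e, x 0 i[}.
    apply: (@choice _ _ (fun i q => (ratr q : R) \in `]x 0 i - e, x 0 i[)) => i.
    by apply/rat_in_itvoo; rewrite gtrBl.
  have [b xb] : {b : 'I_d -> rat & forall i, ratr (b i) \in `]x 0 i, x 0 i + e[}.
    apply: (@choice _ _ (fun i q => (ratr q : R) \in `]x 0 i, x 0 i + e[)) => i.
    by apply/rat_in_itvoo; rewrite ltrDl.
  exists (\row_i a i, \row_i b i) => //.
  rewrite asboolT => [i|y By].
    rewrite !mxE; have /andP[_ ax] := xa i; have /andP[bx _] := xb i.
    by rewrite (ltW ax).
  apply: xU; split=> // i j; rewrite (ord1 i).
  have := By j; rewrite !mxE; have /andP[ax _] := xa j; have /andP[_ bx] := xb j.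
  rewrite /ball/= => /andP[ay yb].
  rewrite ltr_distlC; apply/andP; split; first exact: lt_le_trans ay.
  exact: lt_trans bx.
apply: (@countable_bigcupT_measurable _ (caratheodory_type (@lebesgue_outer R d))).
  exact: countableP.
move=> p; case: asboolP => _; first exact: measurable_box.
exact: measurable0.
Qed.

Lemma continuous_measurable (h : 'rV[R]_d -> R) : continuous h ->
  measurable_fun setT (h : caratheodory_type (@lebesgue_outer R d) -> R).
Proof.
move=> /continuousP ch; apply: (measurability _ (RGenOInfty.measurableE R)).
move=> _ [_ [a ->] <-]; rewrite setTI; apply: measurable_open.
by apply: ch; exact: interval_open.
Qed.

End lebesgue_boxes.

(** * Derivatives from two-sided bounds *)

Section real_functions.
Context (R : realType).
Implicit Types F : R -> R.

Lemma is_derive_first_order F (a l : R) :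
  (forall e, 0 < e -> exists2 dl, 0 < dl & forall r, `|r - a| < dl ->
     `|F r - F a - l * (r - a)| <= e * `|r - a|) ->
  is_derive a 1 F l.
Proof.
move=> Fl.
have cvgF : h^-1 *: ((F \o shift a) (h *: 1) - F a) @[h --> 0^'] --> l.
  apply/cvgrPdist_le => e /Fl[dl dl0 hdl].
  apply/nbhs_ballP; exists dl => //= h; rewrite /ball/= sub0r normrN => hd h0.
  have := hdl (h + a); rewrite addrK => /(_ hd) ha.
  have -> : l - h^-1 *: ((F \o shift a) (h *: 1) - F a) =
    - (h^-1 * (F (h + a) - F a - l * h)).
    rewrite /shift /= /GRing.scale /= mulr1; by field.
  by rewrite normrN normrM normfV ler_pdivrMl ?normr_gt0// [leRHS]mulrC.
split; first exact: cvgP cvgF.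
exact: cvg_lim cvgF.
Qed.

(** Differentiability by comparison: two parabolas with the same value and the
    same slope at [0] squeeze [F]. *)
Lemma is_derive_between_parabolas F (y l b c : R) :
  (forall r, y + r * l + r ^+ 2 * b <= F r <= y + r * l + r ^+ 2 * c) ->
  is_derive (0 : R) 1 F l.
Proof.
move=> bounds.
have F0 : F 0 = y.
  have := bounds 0; rewrite expr0n /= !mul0r !addr0 => yF.
  by apply/eqP; rewrite eq_le andbC.
apply: is_derive_first_order => e e0.
pose K := `|b| + `|c| + 1.
have K0 : 0 < K by rewrite /K ltr_wpDl// addr_ge0.
exists (e / K); first exact: divr_gt0.
move=> r; rewrite subr0 ltr_pdivlMr// F0 => rK.
have : `|F r - y - l * r| <= r ^+ 2 * K.
  have /andP[lo hi] := bounds r; have r2 := sqr_ge0 r.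
  have /ler_normlP[b1 b2] : `|r ^+ 2 * b| <= r ^+ 2 * `|b|.
    by rewrite normrM (ger0_norm r2).
  have /ler_normlP[c1 c2] : `|r ^+ 2 * c| <= r ^+ 2 * `|c|.
    by rewrite normrM (ger0_norm r2).
  have rb := mulr_ge0 r2 (normr_ge0 b); have rc := mulr_ge0 r2 (normr_ge0 c).
  by rewrite ler_norml /K !mulrDr mulr1; apply/andP; split; lra.
move=> /le_trans; apply; rewrite -[r ^+ 2]real_normK ?num_real// expr2 -mulrA.
by rewrite [leRHS]mulrC ler_wpM2l// ltW.
Qed.

End real_functions.

(** * Curves with zero derivative for a seminorm *)

(** The real function [r |-> N (F r - F s)] has zero derivative in the interior,
    since its increments are bounded by those of [F]; the mean value theorem
    makes it constant, and it vanishes at [s]. *)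
Lemma static_semi_norm (R : realType) (X : lmodType R) (P : set X)
    (B : X -> X -> R) (hB : semi_inner P B) (T : R) (F : R -> X) :
  (forall t, 0 <= t <= T -> P (F t)) ->
  time_continuous (semi_norm B) T F ->
  time_derivative0 (semi_norm B) T F ->
  forall s t, 0 <= s <= T -> 0 <= t <= T -> semi_norm B (F t - F s) = 0.
Proof.
move=> PF Fc F0.
have PB s t : 0 <= s <= T -> 0 <= t <= T -> P (F s - F t).
  by move=> s0T t0T; apply: (semi_inner_domB hB); exact: PF.
have N0 : semi_norm B 0 = 0.
  by rewrite /semi_norm (semi_inner0l hB) ?sqrtr0//; exact: (semi_inner_dom0 hB).
have sym s t : 0 <= s <= T -> 0 <= t <= T ->
    semi_norm B (F s - F t) = semi_norm B (F t - F s).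
  move=> s0T t0T.
  have -> : F s - F t = -1 *: (F t - F s) by rewrite scaleN1r opprB.
  rewrite (semi_normZ hB); last exact: PB.
  by rewrite normrN1 mul1r.
move=> s t s0T t0T.
wlog st : s t s0T t0T / s <= t.
  move=> wl; have [|/ltW] := leP s t; first exact: wl.
  by rewrite sym//; exact: wl.
move: st; rewrite le_eqVlt => /predU1P[->|st].
  by rewrite subrr.
pose D r := semi_norm B (F r - F s).
have DB r r' : 0 <= r <= T -> 0 <= r' <= T ->
    `|D r - D r'| <= semi_norm B (F r - F r').
  move=> r0T r'0T.
  have tri a b : 0 <= a <= T -> 0 <= b <= T -> D a <= semi_norm B (F a - F b) + D b.
    move=> a0T b0T; have := semi_normD hB (PB a b a0T b0T) (PB b s b0T s0T).
    by rewrite addrA subrK.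
  rewrite ler_distl; have := tri r r' r0T r'0T; have := tri r' r r'0T r0T.
  by rewrite (sym r' r)//; lra.
have sub0T r : s <= r <= t -> 0 <= r <= T.
  by move: s0T t0T => /andP[? ?] /andP[? ?] /andP[? ?]; lra.
have dD x : x \in `]s, t[ -> is_derive x 1 D 0.
  rewrite in_itv/= => /andP[sx xt]; apply: is_derive_first_order => e e0.
  have x0T : 0 < x < T by move: s0T t0T => /andP[? ?] /andP[? ?]; lra.
  have /cvgrPdist_le/(_ e e0) := F0 x x0T.
  move=> /nbhs_ballP[d /= d0 hd].
  exists (Num.min d (Num.min (x - s) (t - x))).
    by rewrite !lt_min d0 !subr_gt0 sx.
  move=> r; rewrite !lt_min => /andP[rd /andP[rs rt]].
  rewrite mul0r subr0; have [->|rx] := eqVneq r x.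
    by rewrite !subrr normr0 mulr0.
  have r0T : 0 <= r <= T.
    by apply: sub0T; move: rs rt; rewrite !ltr_norml => /andP[? ?] /andP[? ?]; lra.
  have {}x0T : 0 <= x <= T by move: x0T => /andP[/ltW -> /ltW ->].
  apply: le_trans (DB _ _ r0T x0T) _.
  have := hd r; rewrite /ball/= distrC => /(_ rd rx).
  rewrite sub0r normrN (semi_normZ hB); last exact: PB.
  rewrite normrM normr_id normfV ler_pdivrMl ?normr_gt0 ?subr_eq0// mulrC.
  by apply: le_trans; exact: ler_norm.
have cD : {within `[s, t], continuous D}.
  apply/subspace_continuousP => x /=; rewrite in_itv/= => /sub0T x0T.
  apply/cvgrPdist_le => e e0.
  have /cvgrPdist_le/(_ e e0) := Fc x x0T.
  move=> /nbhs_ballP[d /= d0 hd].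
  apply/nbhs_ballP; exists d => //= r xr; rewrite in_itv/= => /sub0T r0T.
  have := hd r xr; rewrite /= in_itv/= => /(_ r0T).
  rewrite sub0r normrN distrC; apply: le_trans.
  by apply: le_trans (DB _ _ r0T x0T) _; exact: ler_norm.
have [c _] := MVT st dD cD.
rewrite mul0r /D subrr => /eqP; rewrite subr_eq0 => /eqP ->.
exact: N0.
Qed.

(** * The Sobolev space [H^1] *)

Section H1_theory.
Context (R : realType) (d : nat) (Om : set 'rV[R]_d).
Hypothesis Om_bounded : exists M : R, forall x, Om x -> enorm x <= M.

Lemma bounded_box : exists M : R,
  Om `<=` box (const_mx (- M)) (const_mx M : 'rV[R]_d).
Proof.
have [M OmM] := Om_bounded; exists (M + 1) => x /OmM xM i; rewrite !mxE.
have : `|x 0 i| <= enorm x.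
  rewrite -sqrtr_sqr ler_sqrt ?mdot_ge0// /mdot big_ord1 (bigD1 i)//= -expr2.
  by rewrite lerDl sumr_ge0// => j _; rewrite -expr2 sqr_ge0.
move=> /le_trans/(_ xM); rewrite ler_norml => /andP[Mx xM'].
by apply/andP; split; lra.
Qed.

(** On a bounded set, [|v h| <= v^2 + h^2] where [h^2] is bounded. This makes
    both sides of the definition of weak derivatives additive: a priori, the
    integral of a sum splits only for integrable functions. *)
Lemma integrable_L2_continuous (v : 'rV[R]_d -> R) (h : 'rV[R]_d -> R) :
  v \_ Om \in Lfun (lebesgue R d) 2%:E -> continuous h ->
  (lebesgue R d).-integrable setT (EFin \o ((fun x => v x * h x) \_ Om)).
Proof.
move=> v2 ch; have [M OmM] := bounded_box.
set Q := box _ _ in OmM.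
have mh := continuous_measurable ch.
have mQ : measurable (Q : set (caratheodory_type (@lebesgue_outer R d))).
  exact: measurable_box.
have mv : measurable_fun setT (v \_ Om : caratheodory_type (@lebesgue_outer R d) -> R).
  by move: v2; rewrite inE => /andP[]; rewrite inE.
have cK : compact [set x : 'rV[R]_d | forall i, `[- M, M]%classic (x 0 i)].
  by apply: (@rV_compact R d (fun=> `[- M, M]%classic)) => _; exact: segment_compact.
have hQ : [bounded h x ^+ 2 | x in Q].
  have := compact_bounded (continuous_compact (continuous_subspaceT ch) cK).
  move=> [C [Cr hC]]; exists ((`|C| + 1) ^+ 2); split; first exact: num_real.
  move=> y Cy x Qx; apply: le_trans (ltW Cy); rewrite normrX.
  rewrite ler_pXn2r ?nnegrE ?addr_ge0//; apply: hC.
    by rewrite (le_lt_trans (ler_norm _))// ltrDl.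
  exists x => //= i; have := Qx i; rewrite !mxE /= in_itv/= => /andP[-> /ltW ->] //.
have ih : (lebesgue R d).-integrable setT ((EFin \o (fun x => h x ^+ 2)) \_ Q).
  apply/(integrable_mkcond _ mQ)/measurable_bounded_integrable => //.
  - exact: lebesgue_box_lty.
  - by apply: measurable_funTS; exact: measurable_funX.
have iv := Lfun2_integrable_sqr v2.
have E : (fun x => v x * h x) \_ Om = v \_ Om \* h.
  by apply/funext => x; rewrite /patch/=; case: ifP => //; rewrite mul0r.
apply: le_integrable (integrableD measurableT iv ih) => //.
  by rewrite E; apply/measurable_EFinP; exact: measurable_funM.
move=> x _; rewrite E; have [Omx|Omx] := boolP (x \in Om); last first.
  have v0 : (v \_ Om) x = 0 by rewrite /patch (negbTE Omx).
  by rewrite /= v0 mul0r normr0 abse_ge0.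
have vx : (v \_ Om) x = v x by rewrite /patch Omx.
have hx : ((EFin \o (fun x => h x ^+ 2)) \_ Q) x = (h x ^+ 2)%:E.
  by rewrite /patch mem_set//; apply: OmM; exact: set_mem.
rewrite /= hx vx lee_fin [leRHS]ger0_norm ?addr_ge0 ?sqr_ge0// normrM.
rewrite -[v x ^+ 2]real_normK ?num_real// -[h x ^+ 2]real_normK ?num_real//.
by have := sqr_ge0 (`|v x| - `|h x|); have := sqr_ge0 (`|v x| + `|h x|); nra.
Qed.

Lemma weak_gradient_lin (a : R) (u v : vfield R d) (G H : tfield R d) :
  L2 (lebesgue R d) Om u -> L2 (lebesgue R d) Om v ->
  L2 (lebesgue R d) Om G -> L2 (lebesgue R d) Om H ->
  weak_gradient Om u G -> weak_gradient Om v H ->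
  weak_gradient Om (a *: u + v) (a *: G + H).
Proof.
move=> u2 v2 G2 H2 uG vH f tf i j.
have [sf _ _] := tf.
have cf : continuous f by have [] := sf [::].
have cdf : continuous (partial j f) by have [] := sf [:: j].
have lin (w z h : 'rV[R]_d -> R) : w \_ Om \in Lfun (lebesgue R d) 2%:E ->
    z \_ Om \in Lfun (lebesgue R d) 2%:E -> continuous h ->
    \int[lebesgue R d]_(x in Om) ((a * w x + z x) * h x) =
    a * \int[lebesgue R d]_(x in Om) (w x * h x) +
    \int[lebesgue R d]_(x in Om) (z x * h x).
  move=> w2 z2 ch.
  have iw := integrable_L2_continuous w2 ch.
  have iz := integrable_L2_continuous z2 ch.
  rewrite [LHS]Rintegral_mkcond [X in _ = _ * X + _]Rintegral_mkcond.
  rewrite [X in _ = _ + X]Rintegral_mkcond -RintegralZl// -RintegralD//; last first.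
    exact: (integrableZl measurableT a iw).
  apply: eq_Rintegral => x _; rewrite /patch; case: ifP => _ /=; last first.
    by rewrite mulr0 addr0.
  by rewrite mulrDl mulrA.
transitivity (\int[lebesgue R d]_(x in Om) ((a * u x 0 i + v x 0 i) * partial j f x)).
  by apply: eq_Rintegral => x _; rewrite -[(_ + _) x]/(a *: u x + v x) !mxE.
rewrite (lin (fun x => u x 0 i) (fun x => v x 0 i))//.
transitivity (- \int[lebesgue R d]_(x in Om) ((a * G x i j + H x i j) * f x)); last first.
  by congr (- _); apply: eq_Rintegral => x _; rewrite -[(_ + _) x]/(a *: G x + H x) !mxE.
rewrite (lin (fun x => G x i j) (fun x => H x i j))//.
by rewrite uG// vH// opprD mulrN.
Qed.

Definition H1dot (u v : vfield R d * tfield R d) : R :=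
  L2dot (lebesgue R d) Om u.1 v.1 + L2dot (lebesgue R d) Om u.2 v.2.

Lemma H1_semi_inner : semi_inner (H1 Om) H1dot.
Proof.
have h1 := @L2_semi_inner _ _ R (lebesgue R d) Om 1 d.
have h2 := @L2_semi_inner _ _ R (lebesgue R d) Om d d.
split.
- split; [exact: L2_0|exact: L2_0|].
  move=> f _ i j.
  have int0 (h : 'rV[R]_d -> R) : (forall x, h x = 0) ->
      \int[lebesgue R d]_(x in Om) h x = 0.
    move=> h0; rewrite /Rintegral (eq_integral (cst 0%E)) ?integral0//.
    by move=> x _; rewrite h0.
  by rewrite !int0 ?oppr0// => x; rewrite mxE mul0r.
- move=> a u v [u1 u2 uG] [v1 v2 vG]; split; [exact: L2_lin|exact: L2_lin|].
  exact: weak_gradient_lin.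
- move=> a u v w [u1 u2 _] [v1 v2 _] [w1 w2 _].
  by rewrite /H1dot (semi_inner_lin h1)// (semi_inner_lin h2)//; ring.
- by move=> u v; rewrite /H1dot (semi_innerC h1) (semi_innerC h2).
- by move=> u [u1 u2 _]; rewrite addr_ge0 ?(semi_inner_ge0 h1) ?(semi_inner_ge0 h2).
Qed.

Lemma H1normE : H1norm Om = semi_norm H1dot.
Proof.
by apply/funext => u; rewrite /H1norm /L2norm !sqr_sqrtr ?L2dot_ge0.
Qed.

End H1_theory.

(** * Extension by zero *)

(** The boundary load lives on a part of the boundary, traces on the whole of
    it. Extending the load by zero puts both in the same [L^2] space. *)
Definition extend0 (R : nzRingType) (T : Type) m n (N : set T)
    (q : T -> 'M[R]_(m, n)) : T -> 'M[R]_(m, n) :=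
  fun x => (x \in N)%:R *: q x.

Section L2_subdomain.
Context (disp : measure_display) (T : measurableType disp) (R : realType).
Context (mu : {measure set T -> \bar R}) (m n : nat) (N D : set T).
Hypothesis ND : N `<=` D.

Implicit Types q w : T -> 'M[R]_(m, n).

Lemma L2_extend0 q : L2 mu N q -> L2 mu D (extend0 N q).
Proof.
move=> q2 i j; rewrite (_ : _ \_ D = (fun x => q x i j) \_ N); first exact: q2.
apply/funext => x; rewrite /patch; have [xN|xN] := boolP (x \in N).
  by rewrite mem_set ?mxE ?xN ?mul1r//; apply: ND; exact: set_mem.
by case: ifP => // _; rewrite mxE (negbTE xN) mul0r.
Qed.

Lemma L2dot_extend0 q w : L2dot mu N q w = L2dot mu D (extend0 N q) w.
Proof.
rewrite !L2dotE; congr (Rintegral _ _ _); apply/funext => x; rewrite /patch.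
have [xN|xN] := boolP (x \in N).
  rewrite mem_set; last by apply: ND; exact: set_mem.
  by rewrite /extend0 xN scale1r.
case: ifP => // _; rewrite /extend0 (negbTE xN) scale0r /mdot.
by rewrite big1// => i _; rewrite big1// => j _; rewrite mxE mul0r.
Qed.

End L2_subdomain.

(** * The forms of linear elasticity *)

Section stiffness.
Context (R : realType) (d : nat) (lambda mu : R).
Notation stiffM := (stiffM lambda mu).
Implicit Types A B : 'M[R]_d.

Lemma stiffM_lin a A B : stiffM (a *: A + B) = a *: stiffM A + stiffM B.
Proof.
apply/matrixP => i j; rewrite !mxE mulr_sumr -big_split; apply: eq_bigr => k _.
by rewrite mulr_sumr -big_split; apply: eq_bigr => l _; rewrite !mxE /=; ring.
Qed.

(** The symmetry [c_ijkl = c_klij], which makes [C] a symmetric bilinear form. *)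
Lemma stiff_major_sym (i j k l : 'I_d) :
  stiff lambda mu i j k l = stiff lambda mu k l i j.
Proof.
rewrite /stiff [k == i]eq_sym [l == j]eq_sym [k == j]eq_sym [l == i]eq_sym.
by rewrite [(j == k)%:R * _]mulrC; ring.
Qed.

Lemma mdot_stiffM A B : mdot (stiffM A) B =
  \sum_i \sum_j \sum_k \sum_l stiff lambda mu i j k l * B i j * A k l.
Proof.
apply: eq_bigr => i _; apply: eq_bigr => j _.
rewrite mxE mulr_suml; apply: eq_bigr => k _.
by rewrite mulr_suml; apply: eq_bigr => l _; ring.
Qed.

Lemma mdot_stiffMC A B : mdot (stiffM A) B = mdot (stiffM B) A.
Proof.
have pairs C D : mdot (stiffM C) D = \sum_(p : 'I_d * 'I_d) \sum_(q : 'I_d * 'I_d)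
    stiff lambda mu p.1 p.2 q.1 q.2 * D p.1 p.2 * C q.1 q.2.
  by rewrite mdot_stiffM pair_bigA; apply: eq_bigr => p _; rewrite pair_bigA.
rewrite !pairs exchange_big; apply: eq_bigr => q _; apply: eq_bigr => p _.
by rewrite stiff_major_sym; ring.
Qed.

Lemma mdot_stiffM_ge0 A : stiff_positive d lambda mu -> A^T = A ->
  0 <= mdot (stiffM A) A.
Proof.
move=> [c c0 +] AT => /(_ A AT); rewrite mdot_stiffM; apply: le_trans.
rewrite mulr_ge0 ?(ltW c0)// sumr_ge0// => i _; rewrite sumr_ge0// => j _.
exact: sqr_ge0.
Qed.

End stiffness.

Section elastic_forms.
Context (R : realType) (d : nat) (lambda mu : R) (Om : set 'rV[R]_d).

Lemma strain_lin a (u v : vfield R d * tfield R d) :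
  strain (a *: u + v) = a *: strain u + strain v.
Proof.
apply/funext => x.
rewrite -[LHS]/(2^-1 *: ((a *: u.2 x + v.2 x) + (a *: u.2 x + v.2 x)^T)).
rewrite -[RHS]/(a *: strain u x + strain v x) /strain.
by apply/matrixP => i j; rewrite !mxE; ring.
Qed.

Lemma strainD (u v : vfield R d * tfield R d) :
  strain (u + v) = strain u + strain v.
Proof. by rewrite -[u in LHS]scale1r strain_lin scale1r. Qed.

Lemma strainB (u v : vfield R d * tfield R d) :
  strain (u - v) = strain u - strain v.
Proof. by rewrite addrC -scaleN1r strain_lin scaleN1r addrC. Qed.

Lemma L2_stiffM (F : tfield R d) : L2 (lebesgue R d) Om F ->
  L2 (lebesgue R d) Om (fun x => stiffM lambda mu (F x)).
Proof.
move=> F2 i j.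
have -> : (fun x => stiffM lambda mu (F x) i j) \_ Om =
    \sum_k \sum_l (stiff lambda mu i j k l *: ((fun x => F x k l) \_ Om) + 0).
  apply/funext => x; rewrite fct_sumE; under eq_bigr do rewrite fct_sumE/=.
  have t k l : (stiff lambda mu i j k l *: ((fun x => F x k l) \_ Om) + 0) x =
      stiff lambda mu i j k l * (if x \in Om then F x k l else 0).
    rewrite -[RHS]addr0; congr (_ + _).
  rewrite {1}/patch; have [xO|xO] := boolP (x \in Om).
    by rewrite mxE; apply: eq_bigr => k _; apply: eq_bigr => l _; rewrite t xO.
  rewrite [RHS]big1// => k _; rewrite big1// => l _.
  by rewrite t (negbTE xO) mulr0.
have p1 : (1 <= 2%:E :> \bar R)%E by rewrite lee_fin ler1n.
have [L0 L1] := Lfun_addr_closed (lebesgue R d) p1.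
elim/big_ind : _ => // k _; elim/big_ind : _ => // l _.
by apply: Lfun2_lin => //; exact: F2.
Qed.

Lemma Psi_lin a (phi psi : tfield R d) :
  Psi Om phi -> Psi Om psi -> Psi Om (a *: phi + psi).
Proof.
move=> [p2 pT] [q2 qT]; split=> [|x Ox]; first exact: L2_lin.
by rewrite -[(_ + _) x]/(a *: phi x + psi x) linearP/= pT// qT.
Qed.

Lemma Psi0 : Psi Om (0 : tfield R d).
Proof. by split=> [|x _]; [exact: L2_0|exact: trmx0]. Qed.

Lemma Psi_strain u : H1 Om u -> Psi Om (strain u).
Proof.
move=> [_ u2 _]; split=> [|x _]; last first.
  by rewrite /strain linearZ linearD/= trmxK addrC.
have h := @L2_semi_inner _ _ R (lebesgue R d) Om d d.
have uT2 : L2 (lebesgue R d) Om (fun x => (u.2 x)^T).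
  move=> i j; have -> : (fun x => (u.2 x)^T i j) = (fun x => u.2 x j i).
    by apply/funext => x; rewrite mxE.
  exact: u2.
exact: (semi_inner_domZ h _ (semi_inner_domD h u2 uT2)).
Qed.

Lemma dotPsi_semi_inner : semi_inner (Psi Om) (dotPsi Om).
Proof.
have h := @L2_semi_inner _ _ R (lebesgue R d) Om d d.
split; [exact: Psi0|exact: Psi_lin| | |].
- by move=> a x y z [x2 _] [y2 _] [z2 _]; exact: (semi_inner_lin h).
- exact: (semi_innerC h).
- by move=> x [x2 _]; exact: (semi_inner_ge0 h).
Qed.

Lemma dotC_semi_inner : stiff_positive d lambda mu ->
  semi_inner (Psi Om) (dotC lambda mu Om).
Proof.
move=> hC; have h := @L2_semi_inner _ _ R (lebesgue R d) Om d d.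
split; [exact: Psi0|exact: Psi_lin| | |].
- move=> a x y z [x2 _] [y2 _] [z2 _]; rewrite /dotC /dotPsi.
  rewrite -(semi_inner_lin h)//; [|exact: L2_stiffM..].
  by congr L2dot; apply/funext => t; exact: stiffM_lin.
- by move=> x y; apply: eq_Rintegral => t _; exact: mdot_stiffMC.
- move=> x [_ xT]; apply: Rintegral_ge0 => t Ot.
  by apply: mdot_stiffM_ge0 => //; exact: xT.
Qed.

Lemma sqr_normPsi psi : normPsi Om psi ^+ 2 = dotPsi Om psi psi.
Proof.
by rewrite sqr_sqrtr// L2dot_ge0.
Qed.

Lemma sqr_normC psi : stiff_positive d lambda mu -> Psi Om psi ->
  normC lambda mu Om psi ^+ 2 = dotC lambda mu Om psi psi.
Proof.
by move=> hC Ppsi; rewrite sqr_sqrtr//; exact: (semi_inner_ge0 (dotC_semi_inner hC)).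
Qed.

Lemma normPsiZ a psi : Psi Om psi ->
  normPsi Om (a *: psi) ^+ 2 = a ^+ 2 * normPsi Om psi ^+ 2.
Proof.
move=> Ppsi; have h := dotPsi_semi_inner; have Pa := semi_inner_domZ h a Ppsi.
by rewrite !sqr_normPsi (semi_innerZl h)// (semi_innerZr h)// mulrA.
Qed.

Lemma normCZ a psi : stiff_positive d lambda mu -> Psi Om psi ->
  normC lambda mu Om (a *: psi) ^+ 2 = a ^+ 2 * normC lambda mu Om psi ^+ 2.
Proof.
move=> hC Ppsi; have h := dotC_semi_inner hC; have Pa := semi_inner_domZ h a Ppsi.
by rewrite !sqr_normC// (semi_innerZl h)// (semi_innerZr h)// mulrA.
Qed.

End elastic_forms.

(** * Admissible displacements and loads *)

Section admissible_displacements.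
Context (R : realType) (d : nat) (Om Gam0 : set 'rV[R]_d).
Context (gam : vfield R d * tfield R d -> vfield R d).
Hypothesis Om_bounded : exists M : R, forall x, Om x -> enorm x <= M.
Hypothesis Gam0_boundary : Gam0 `<=` boundary Om.
Hypothesis hgam : trace_operator Om gam.
Implicit Types u v w g : vfield R d * tfield R d.

Let ae_filter : Filter (nbhs (almost_everywhere (surface R d))).
Proof. exact: (ae_filter_ringOfSetsType (surface R d)). Qed.
#[local] Existing Instance ae_filter.

Let hH1 := H1_semi_inner Om_bounded.

(** [0 = (-1) 0 + 0], and the trace is linear almost everywhere. *)
Lemma trace0 : {ae surface R d, forall x, boundary Om x -> gam 0 x = 0}.
Proof.
have H0 := semi_inner_dom0 hH1.
have := trace_linear hgam (-1) H0 H0; rewrite scaler0 addr0.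
by apply: filterS => x gx /gx ->; rewrite scaleN1r addNr.
Qed.

Lemma trace_null g : H1 Om g -> H1norm Om g = 0 ->
  {ae surface R d, forall x, boundary Om x -> gam g x = 0}.
Proof.
move=> Hg g0; apply: L2norm0_ae; first exact: (trace_L2 hgam).
have [K /(_ g Hg)] := trace_bounded hgam; rewrite g0 mulr0 => gle.
by apply/eqP; rewrite eq_le gle sqrtr_ge0.
Qed.

Lemma affVB g u v : affV Om Gam0 gam g u -> affV Om Gam0 gam g v ->
  affV Om Gam0 gam 0 (u - v).
Proof.
move=> [Hu ug] [Hv vg]; split; first exact: (semi_inner_domB hH1).
have {ug vg} : {ae surface R d, forall x, Gam0 x -> gam u x = gam v x}.
  by move: ug vg; apply: filterS2 => x ug vg Gx; rewrite ug// vg.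
have := trace_linear hgam (-1) Hv Hu; rewrite scaleN1r [- v + u]addrC.
move: trace0; apply: filterS3 => x g0 guv uv Gx; have Bx := Gam0_boundary Gx.
by rewrite guv// g0// uv// scaleN1r addNr.
Qed.

(** The trace is bounded, so it does not see a null [H^1] function: boundary data
    at zero [H^1] distance define the same affine space. *)
Lemma affV_static g g' : H1 Om g -> H1 Om g' -> H1norm Om (g' - g) = 0 ->
  affV Om Gam0 gam g `<=` affV Om Gam0 gam g'.
Proof.
move=> Hg Hg' gg' u [Hu ug]; split=> //.
have /trace_null/(_ gg') := semi_inner_domB hH1 Hg' Hg.
have := trace_linear hgam (-1) Hg Hg'; rewrite scaleN1r [- g + g']addrC.
move: ug; apply: filterS3 => x ug gl g0 Gx.
have Bx := Gam0_boundary Gx.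
by have := g0 Bx; rewrite gl// scaleN1r addrC ug// => /eqP; rewrite subr_eq0 => /eqP.
Qed.

Lemma neumann_boundary : neumann_part Om Gam0 `<=` boundary Om.
Proof. by move=> x []. Qed.

Notation N := (neumann_part Om Gam0).

Let L2_ext (q : vfield R d) (q2 : L2 (surface R d) N q) :
    L2 (surface R d) (boundary Om) (extend0 N q) :=
  @L2_extend0 _ _ R (surface R d) 1 d _ _ neumann_boundary q q2.

Let dot_ext (q w : vfield R d) : L2dot (surface R d) N q w =
    L2dot (surface R d) (boundary Om) (extend0 N q) w :=
  @L2dot_extend0 _ _ R (surface R d) 1 d _ _ neumann_boundary q w.

Lemma load_lin (f q : vfield R d) a u v : L2 (lebesgue R d) Om f -> L2 (surface R d) N q ->
  H1 Om u -> H1 Om v ->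
  load Om Gam0 gam f q (a *: u + v) =
  a * load Om Gam0 gam f q u + load Om Gam0 gam f q v.
Proof.
move=> f2 q2 Hu Hv; have [u2 _ _] := Hu; have [v2 _ _] := Hv.
have h := @L2_semi_inner _ _ R (lebesgue R d) Om 1 d.
have hb := @L2_semi_inner _ _ R (surface R d) (boundary Om) 1 d.
have qe2 := L2_ext q2.
have gu2 := trace_L2 hgam Hu; have gv2 := trace_L2 hgam Hv.
have guv2 := trace_L2 hgam (semi_inner_dom hH1 a Hu Hv).
rewrite /load !dot_ext.
rewrite (semi_innerC h f) (semi_inner_lin h)// (semi_innerC hb).
rewrite (L2dot_ae guv2 (semi_inner_dom hb a gu2 gv2) qe2); last first.
  exact: (trace_linear hgam).
rewrite (semi_inner_lin hb)// !(semi_innerC h f) !(semi_innerC hb (extend0 _ _)).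
by ring.
Qed.

Lemma loadD (f q : vfield R d) u v : L2 (lebesgue R d) Om f -> L2 (surface R d) N q ->
  H1 Om u -> H1 Om v ->
  load Om Gam0 gam f q (u + v) =
  load Om Gam0 gam f q u + load Om Gam0 gam f q v.
Proof.
by move=> f2 q2 Hu Hv; have := load_lin 1 f2 q2 Hu Hv; rewrite scale1r mul1r.
Qed.

Lemma load_static (f f' q q' : vfield R d) v :
  L2 (lebesgue R d) Om f -> L2 (lebesgue R d) Om f' ->
  L2 (surface R d) N q -> L2 (surface R d) N q' ->
  L2norm (lebesgue R d) Om (f' - f) = 0 -> L2norm (surface R d) N (q' - q) = 0 ->
  H1 Om v -> load Om Gam0 gam f' q' v = load Om Gam0 gam f q v.
Proof.
move=> f2 f2' q2 q2' f0 q0 Hv; have [v2 _ _] := Hv.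
have h := @L2_semi_inner _ _ R (lebesgue R d) Om 1 d.
have hN := @L2_semi_inner _ _ R (surface R d) N 1 d.
have hb := @L2_semi_inner _ _ R (surface R d) (boundary Om) 1 d.
have gv2 := trace_L2 hgam Hv.
rewrite /load; congr (_ + _); apply/eqP; rewrite -subr_eq0; apply/eqP.
  rewrite -(semi_innerBl h)//; apply: (semi_inner_null h) => //.
  exact: (semi_inner_domB h).
have qq2 := semi_inner_domB hN q2' q2.
rewrite !dot_ext -(semi_innerBl hb)//;
  [|exact: L2_ext..].
have -> : extend0 N q' - extend0 N q = extend0 N (q' - q).
  by apply/funext => x; rewrite /extend0 -[LHS]/(_ *: q' x - _ *: q x) -scalerBr.
apply: (semi_inner_null hb) => //; first exact: L2_ext.
rewrite -[RHS]q0 /semi_norm /L2norm -dot_ext.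
congr Num.sqrt; apply: eq_Rintegral => x xN.
by rewrite /extend0 xN scale1r.
Qed.

End admissible_displacements.

(** * Expansion of the energy and of the reduced energy *)

Section energy_expansion.
Context (R : realType) (d : nat) (lambda mu alpha : R) (Om Gam0 : set 'rV[R]_d).
Context (gam : vfield R d * tfield R d -> vfield R d).
Hypothesis Om_bounded : exists M : R, forall x, Om x -> enorm x <= M.
Hypothesis Gam0_boundary : Gam0 `<=` boundary Om.
Hypothesis hgam : trace_operator Om gam.
Hypothesis hC : stiff_positive d lambda mu.
Context (f q : vfield R d) (u : vfield R d * tfield R d) (phi : tfield R d).
Hypothesis f_L2 : L2 (lebesgue R d) Om f.
Hypothesis q_L2 : L2 (surface R d) (neumann_part Om Gam0) q.
Hypothesis u_H1 : H1 Om u.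
Hypothesis phi_Psi : Psi Om phi.
Hypothesis equilibrium : forall v, affV Om Gam0 gam 0 v ->
  dotPsi Om (stress lambda mu u phi) (strain v) = load Om Gam0 gam f q v.

Notation energy := (energy lambda mu Om Gam0 gam alpha f q).
Notation slope := (alpha *: phi - stress lambda mu u phi).

#[local] Opaque normC normPsi.

Let hP := dotPsi_semi_inner Om.
Let hCP := dotC_semi_inner Om hC.

(** The energy is quadratic, so its expansion is exact. At an equilibrium, the
    terms linear in the displacement [w] cancel: only the internal variable
    feels a first order change, and what remains of [w] is a square. *)
Lemma energy_shift w chi : affV Om Gam0 gam 0 w -> Psi Om chi ->
  energy (u + w) (phi + chi) = energy u phi + dotPsi Om slope chi
    + alpha / 2 * normPsi Om chi ^+ 2
    + 2^-1 * normC lambda mu Om (strain w - chi) ^+ 2.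
Proof.
move=> Vw Pchi; have [Hw _] := Vw.
have Pu := Psi_strain u_H1; have Pw := Psi_strain Hw.
have Pa := semi_inner_domB hP Pu phi_Psi.
have Pb := semi_inner_domB hP Pw Pchi.
have P2 (F : tfield R d) : Psi Om F -> L2 (lebesgue R d) Om F by case.
have h := @L2_semi_inner _ _ R (lebesgue R d) Om d d.
have s2 : L2 (lebesgue R d) Om (stress lambda mu u phi).
  by apply: L2_stiffM; exact: P2.
have -> : dotPsi Om slope chi =
    alpha * dotPsi Om phi chi - dotPsi Om (stress lambda mu u phi) chi.
  rewrite /dotPsi (semi_innerBl h) ?(semi_innerZl h)//; try exact: P2.
  by apply: (semi_inner_domZ h); exact: P2.
rewrite /energy.
have -> : strain (u + w) - (phi + chi) = (strain u - phi) + (strain w - chi).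
  by rewrite strainD opprD addrACA.
have Pab := semi_inner_domD hP Pa Pb.
have Pphi := semi_inner_domD hP phi_Psi Pchi.
rewrite (sqr_normC hC Pab) (sqr_normC hC Pa) (sqr_normC hC Pb) !sqr_normPsi.
have Cab : dotC lambda mu Om (strain u - phi) (strain w - chi) =
    load Om Gam0 gam f q w - dotPsi Om (stress lambda mu u phi) chi.
  by rewrite -equilibrium// /dotC /dotPsi -(semi_innerBr h)//; exact: P2.
move: (strain u - phi) (strain w - chi) Pa Pb Pab Cab => a b Pa Pb Pab Cab.
rewrite (semi_innerDl hCP Pa Pb Pab) !(semi_innerDr hCP Pa Pb) //.
rewrite (semi_innerC hCP b a) Cab (semi_innerDl hP phi_Psi Pchi Pphi).
rewrite !(semi_innerDr hP phi_Psi Pchi) // (semi_innerC hP chi phi).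
rewrite (loadD Om_bounded hgam f_L2 q_L2 u_H1 Hw).
by field.
Qed.


Context (g : vfield R d * tfield R d).
Hypothesis u_V : affV Om Gam0 gam g u.

Notation Estar := (reduced_energy lambda mu Om Gam0 gam alpha f q g).

(** The energy at [phi + chi] if the elastic strain could follow [chi] without
    cost. *)
Let relaxed_energy chi : R :=
  energy u phi + dotPsi Om slope chi + alpha / 2 * normPsi Om chi ^+ 2.

(** In [energy_shift] the last square is nonnegative, and equals the square of
    the [C]-norm of [chi] when the displacement is kept fixed. Hence the infimum
    over displacements is known up to a second order error. *)
Lemma reduced_energy_bounds chi : Psi Om chi ->
  relaxed_energy chi <= Estar (phi + chi) <=
  relaxed_energy chi + 2^-1 * normC lambda mu Om chi ^+ 2.
Proof.
move=> Pchi; set Q := relaxed_energy chi.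
have lb v : affV Om Gam0 gam g v -> Q <= energy v (phi + chi).
  move=> Vv; have Vw := affVB Om_bounded Gam0_boundary hgam Vv u_V.
  have := energy_shift Vw Pchi; rewrite [u + _]addrC subrK => ->.
  by rewrite lerDl mulr_ge0 ?sqr_ge0.
apply/andP; split.
  apply: lb_le_inf; first by exists (energy u (phi + chi)), u.
  by move=> _ [v Vv <-]; exact: lb.
apply: le_trans (_ : energy u (phi + chi) <= _).
  apply: ge_inf; last by exists u.
  by exists Q => _ [v Vv <-]; exact: lb.
have V0 := affVB Om_bounded Gam0_boundary hgam u_V u_V.
have := energy_shift V0 Pchi; rewrite subrr addr0 => ->.
have S0 : strain (0 : vfield R d * tfield R d) = 0.
  by rewrite -[0 in LHS](subrr u) strainB subrr.
by rewrite -/Q lerD2l S0 sub0r -scaleN1r (normCZ _ hC)// sqrrN expr1n mul1r.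
Qed.

Lemma reduced_energy_is_derive psi : Psi Om psi ->
  is_derive (0 : R) 1 (fun eps : R => Estar (phi + eps *: psi))
    (dotPsi Om slope psi).
Proof.
move=> Ppsi; pose c := alpha / 2 * normPsi Om psi ^+ 2.
pose n := 2^-1 * normC lambda mu Om psi ^+ 2.
have h := @L2_semi_inner _ _ R (lebesgue R d) Om d d.
have slope2 : L2 (lebesgue R d) Om slope.
  apply: (semi_inner_domB h); last by apply: L2_stiffM; exact: (semi_inner_domB hP (Psi_strain u_H1) phi_Psi).1.
  by apply: (semi_inner_domZ h); case: phi_Psi.
apply: (is_derive_between_parabolas (y := energy u phi) (b := c) (c := c + n)).
move=> eps; have := reduced_energy_bounds (semi_inner_domZ hP eps Ppsi).
rewrite /relaxed_energy (normPsiZ eps Ppsi) (normCZ eps hC Ppsi).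
rewrite [dotPsi Om slope _](semi_innerZr h)//; last by case: Ppsi.
by rewrite /c /n !(mulrCA _ (eps ^+ 2)) [eps ^+ 2 * (_ + _)]mulrDr addrA.
Qed.

End energy_expansion.

(** * Gradient flow structure and energy decay *)

#[local] Opaque normC normPsi.

Theorem theorem4p2 (R : realType) (d : nat) (hd : d = 2%N \/ d = 3%N)
  (T tau eta alpha lambda mu : R)
  (T_gt0 : 0 < T) (tau_gt0 : 0 < tau) (eta_gt0 : 0 < eta) (alpha_ge0 : 0 <= alpha)
  (Om Gam0 : set 'rV[R]_d)
  (hOm : bounded_lipschitz_domain Om) (hGam0 : dirichlet_part Om Gam0)
  (gam : vfield R d * tfield R d -> vfield R d) (hgam : trace_operator Om gam)
  (hC : stiff_positive d lambda mu)
  (f : R -> vfield R d) (g : R -> vfield R d * tfield R d) (q : R -> vfield R d)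
  (phi0 : tfield R d)
  (f_L2 : forall t, 0 <= t <= T -> L2 (lebesgue R d) Om (f t))
  (f_cont : time_continuous (fun v : vfield R d => L2norm (lebesgue R d) Om v) T f)
  (g_H1 : forall t, 0 <= t <= T -> H1 Om (g t))
  (g_cont : time_continuous (H1norm Om) T g)
  (q_L2 : forall t, 0 <= t <= T -> L2 (surface R d) (neumann_part Om Gam0) (q t))
  (q_cont : time_continuous
     (fun v : vfield R d => L2norm (surface R d) (neumann_part Om Gam0) v) T q)
  (phi0_Psi : Psi Om phi0)
  (f_static : time_derivative0 (fun v : vfield R d => L2norm (lebesgue R d) Om v) T f)
  (g_static : time_derivative0 (H1norm Om) T g)
  (q_static : time_derivative0
     (fun v : vfield R d => L2norm (surface R d) (neumann_part Om Gam0) v) T q)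
  (u : nat -> vfield R d * tfield R d) (phi : nat -> tfield R d)
  (u_V : forall k, (k <= Num.truncn (T / tau))%N ->
     affV Om Gam0 gam (g (k%:R * tau)) (u k))
  (phi_Psi : forall k, (k <= Num.truncn (T / tau))%N -> Psi Om (phi k))
  (phi_init : {ae lebesgue R d, forall x, Om x -> phi 0%N x = phi0 x})
  (equilibrium : forall k, (k <= Num.truncn (T / tau))%N ->
     forall v, affV Om Gam0 gam 0 v ->
       dotPsi Om (stress lambda mu (u k) (phi k)) (strain v) =
       load Om Gam0 gam (f (k%:R * tau)) (q (k%:R * tau)) v)
  (flow : forall k, (1 <= k <= Num.truncn (T / tau))%N ->
     {ae lebesgue R d, forall x, Om x ->
        (eta *: Dbar tau phi k + alpha *: phi k
         - stress lambda mu (u k) (phi k)) x = 0}) :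
  let t k : R := k%:R * tau in
  let E k : R^o :=
    energy lambda mu Om Gam0 gam alpha (f (t k)) (q (t k)) (u k) (phi k) in
  let Estar k :=
    reduced_energy lambda mu Om Gam0 gam alpha (f (t k)) (q (t k)) (g (t k)) in
  forall k, (1 <= k <= Num.truncn (T / tau))%N ->
  (forall psi, Psi Om psi ->
     gateaux_derivable (Estar k) (phi k) psi /\
     dotPsi Om (eta *: Dbar tau phi k) psi = - gateaux (Estar k) (phi k) psi) /\
  (Dbar tau E k
     + alpha * tau / 2 * normPsi Om (Dbar tau phi k) ^+ 2
     + tau / 2 *
       normC lambda mu Om (Dbar tau (fun j => strain (u j) - phi j) k) ^+ 2
     = - eta * normPsi Om (Dbar tau phi k) ^+ 2 /\
   - eta * normPsi Om (Dbar tau phi k) ^+ 2 <= 0).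
Proof.
move=> t E Estar k kN.
have kT : (k <= Num.truncn (T / tau))%N by case/andP: kN.
have kT' : (k.-1 <= Num.truncn (T / tau))%N by exact: leq_trans (leq_pred _) kT.
have [_ _ _ Om_bounded _] := hOm.
have Gam0_boundary : Gam0 `<=` boundary Om.
  by have [[U _ ->] _ _] := hGam0; exact: subIsetl.
have t0T j : (j <= Num.truncn (T / tau))%N -> 0 <= t j <= T.
  move=> jN; rewrite /t mulr_ge0 ?(ltW tau_gt0)//= -ler_pdivlMr//.
  by rewrite -truncn_ge_nat// divr_ge0 ?ltW.
have tk := t0T k kT; have tk' := t0T k.-1 kT'.
pose hL := @L2_semi_inner _ _ R (lebesgue R d) Om 1 d.
pose hS := @L2_semi_inner _ _ R (surface R d) (neumann_part Om Gam0) 1 d.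
have hH := H1_semi_inner Om_bounded.
(* The data at times [t k.-1] and [t k] are at zero distance, so that the steps
   [k.-1] and [k] share one affine space and one load functional. *)
have f0 : L2norm (lebesgue R d) Om (f (t k) - f (t k.-1)) = 0.
  exact: (static_semi_norm hL f_L2 f_cont f_static).
have q0 : L2norm (surface R d) (neumann_part Om Gam0) (q (t k) - q (t k.-1)) = 0.
  exact: (static_semi_norm hS q_L2 q_cont q_static).
have g0 : H1norm Om (g (t k) - g (t k.-1)) = 0.
  rewrite H1normE in g_cont g_static *.
  exact: (static_semi_norm hH g_H1 g_cont g_static).
have Vk := u_V _ kT; have [Hk _] := Vk; have Pk := phi_Psi _ kT.
have Vk' : affV Om Gam0 gam (g (t k)) (u k.-1).
  apply: (affV_static Om_bounded Gam0_boundary hgam _ _ g0); last exact: u_V.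
    exact: g_H1.
  exact: g_H1.
have [Hk' _] := Vk'; have Pk' := phi_Psi _ kT'.
have fk := f_L2 _ tk; have qk := q_L2 _ tk.
have eqk := equilibrium _ kT.
have hP := dotPsi_semi_inner Om.
have hD := @L2_semi_inner _ _ R (lebesgue R d) Om d d.
pose slope : tfield R d := alpha *: phi k - stress lambda mu (u k) (phi k).
have PD : Psi Om (Dbar tau phi k).
  by apply: (semi_inner_domZ hP); exact: (semi_inner_domB hP).
have slope2 : L2 (lebesgue R d) Om slope.
  apply: (semi_inner_domB hD); first by apply: (semi_inner_domZ hD); case: Pk.
  by apply: L2_stiffM; exact: (semi_inner_domB hP (Psi_strain Hk) Pk).1.
have flowk psi : Psi Om psi ->
    dotPsi Om (eta *: Dbar tau phi k) psi = - dotPsi Om slope psi.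
  move=> [psi2 _]; rewrite -mulN1r -(semi_innerZl hD)//.
  apply: L2dot_ae => //.
  - by apply: (semi_inner_domZ hD); case: PD.
  - exact: (semi_inner_domZ hD).
  have := flow _ kN; apply: (@filterS _ _ (ae_filter_ringOfSetsType (lebesgue R d))).
  move=> x /[apply] fx; apply/eqP; rewrite scaleN1r -subr_eq0 opprK -fx.
  by apply/eqP; rewrite /slope addrA.
split.
  move=> psi Ppsi.
  have dE := reduced_energy_is_derive alpha Om_bounded Gam0_boundary hgam hC fk qk Hk Pk
    eqk Vk Ppsi.
  split; first exact: (@ex_derive _ _ _ _ _ _ _ dE).
  by rewrite flowk// /gateaux derive1E (@derive_val _ _ _ _ _ _ _ dE).
have nD : 0 <= normPsi Om (Dbar tau phi k) ^+ 2 by exact: sqr_ge0.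
split; last by rewrite mulNr oppr_le0 mulr_ge0// ltW.
have tau0 : tau != 0 by rewrite gt_eqF.
pose a j := strain (u j) - phi j.
have Pa j : H1 Om (u j) -> Psi Om (phi j) -> Psi Om (a j).
  by move=> Hj Pj; apply: (semi_inner_domB hP) => //; exact: Psi_strain.
have PDa : Psi Om (Dbar tau a k).
  by apply: (semi_inner_domZ hP); apply: (semi_inner_domB hP); exact: Pa.
(* [energy_shift] is applied at step [k], going back to step [k.-1]. *)
have backphi : phi k.-1 - phi k = (- tau) *: Dbar tau phi k.
  by rewrite /Dbar scalerA mulNr divff// scaleN1r opprB.
have backa : strain (u k.-1 - u k) - (phi k.-1 - phi k) = (- tau) *: Dbar tau a k.
  rewrite /Dbar scalerA mulNr divff// scaleN1r opprB strainB /a.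
  by rewrite !opprB addrACA [in RHS]addrACA; congr (_ + _); rewrite addrC.
have w0 := affVB Om_bounded Gam0_boundary hgam Vk' Vk.
have Pchi := semi_inner_domB hP Pk' Pk.
have dissipation :
    dotPsi Om slope (Dbar tau phi k) = - (eta * normPsi Om (Dbar tau phi k) ^+ 2).
  rewrite -[LHS]opprK -flowk// sqr_normPsi; congr (- _).
  by rewrite [LHS](semi_innerZl hD)//; case: PD.
have := energy_shift alpha Om_bounded hgam hC fk qk Hk Pk eqk w0 Pchi.
rewrite ![_ k + (_ k.-1 - _ k)]addrC !subrK backa (normCZ (- tau) hC PDa).
rewrite backphi (normPsiZ (- tau) PD).
rewrite [dotPsi Om _ (- tau *: _)](semi_innerZr hD)//; last by case: PD.
rewrite [L2dot _ _ _ _]dissipation => shift.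
have -> : Dbar tau E k = tau^-1 * (E k - E k.-1) by [].
have -> : E k.-1 =
    energy lambda mu Om Gam0 gam alpha (f (t k)) (q (t k)) (u k.-1) (phi k.-1).
  rewrite /E /energy; congr (_ - _); symmetry.
  by apply: (load_static hgam) => //; [exact: f_L2|exact: q_L2].
by rewrite shift /E; field.
Qed.
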